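(* Let $M$ be an $(\epsilon)$-para-Sasakian 3-manifold with structure $(\phi,\xi,\eta,g,\epsilon)$, and let $\mathcal{Z}=S+\psi g$ be its $\mathcal{Z}$ tensor, where $S$ is the Ricci tensor and $\psi$ is an arbitrary scalar function on $M$. If $M$ is $\mathcal{Z}$-pseudosymmetric, with associated function $L_{\mathcal{Z}}$, then either $M$ is an Einstein manifold or $L_{\mathcal{Z}}=-\epsilon$ holds on $M$ (that is, on the set $U_{\mathcal{Z}}\subseteq M$ where $L_{\mathcal{Z}}$ is defined).
   Context: An almost para-contact structure on a manifold $M$ consists of a $(1,1)$-tensor field $\phi$, a vector field $\xi$ and a 1-form $\eta$ with $\phi^2=I-\eta\otimes\xi$, $\eta(\xi)=1$, $\phi\xi=0$, $\eta\circ\phi=0$. If $g$ is a semi-Riemannian metric on $M$ with $g(\phi X,\phi Y)=g(X,Y)-\epsilon\,\eta(X)\eta(Y)$ for all vector fields $X,Y$, where $\epsilon=\pm1$ is fixed, then $(\phi,\xi,\eta,g,\epsilon)$ is an $(\epsilon)$-almost para-contact metric structure. It is $(\epsilon)$-para-Sasakian if, with $\nabla$ the Levi-Civita connection of $g$, $(\nabla_X\phi)Y=-g(\phi X,\phi Y)\xi-\epsilon\,\eta(Y)\phi^2X$ for all $X,Y$. An $(\epsilon)$-para-Sasakian 3-manifold is a 3-dimensional manifold with such a structure. $R(X,Y)=[\nabla_X,\nabla_Y]-\nabla_{[X,Y]}$ is the curvature tensor and $S(Y,U)=\operatorname{trace}(X\mapsto R(X,Y)U)$ the Ricci tensor. For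 a scalar function $\psi$ on $M$, the $\mathcal{Z}$ tensor is $\mathcal{Z}(X,Y)=S(X,Y)+\psi\,g(X,Y)$. $M$ is Einstein if $S=\lambda g$ for some constant $\lambda$. Put $(X\wedge_g Y)W=g(Y,W)X-g(X,W)Y$. For a $(0,2)$-tensor $T$ define $(R(X,Y)\cdot T)(U,V)=-T(R(X,Y)U,V)-T(U,R(X,Y)V)$ and $Q(g,T)(U,V;X,Y)=-T((X\wedge_g Y)U,V)-T(U,(X\wedge_g Y)V)$. $M$ is $\mathcal{Z}$-pseudosymmetric if $(R(X,Y)\cdot\mathcal{Z})(U,V)=L_{\mathcal{Z}}\,Q(g,\mathcal{Z})(U,V;X,Y)$ for all $X,Y,U,V$ on the set $U_{\mathcal{Z}}=\{x\in M:\mathcal{Z}\neq0\text{ at }x\}$, where $L_{\mathcal{Z}}$ is some function on $U_{\mathcal{Z}}$.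
   Formalization: The global alternative fails, as L is unconstrained where Z is a multiple of g; what is proved is the pointwise alternative: for one constant λ, at each point of M either S = λg, or the point lies in U_Z and L_Z = −ε there. *)

(* Defs.v *)
From HB Require Import structures.
From mathcomp Require Import all_boot all_order all_algebra.
From mathcomp Require Import all_classical all_reals all_analysis.

Set Implicit Arguments.
Unset Strict Implicit.
Unset Printing Implicit Defensive.

Import Order.TTheory GRing.Theory Num.Theory.
Import numFieldNormedType.Exports.

Local Open Scope classical_set_scope.
Local Open Scope ring_scope.

(* MathComp-Analysis.  Row-vector conventions throughout: a tangent vector is a
   row x, a (1,1)-tensor acts by x |-> x *m F, a 1-form is a column h with value
   x *m h, and 'J f u is the matrix of the differential acting on rows. *)

Section Smooth.
Context (R : realType) (n : nat).

Definition evec (i : 'I_n) : 'rV[R]_n := delta_mx 0 i.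

Definition partial (i : 'I_n) (f : 'rV[R]_n -> R) : 'rV[R]_n -> R :=
  'D_(evec i) f.

(* Used only on open sets U, so continuity at the points of U is continuity on
   U and the values of f outside U do not matter. *)
Fixpoint Ck (k : nat) (U : set 'rV[R]_n) (f : 'rV[R]_n -> R) : Prop :=
  (forall u, U u -> {for u, continuous f}) /\
  if k is k'.+1 then
    forall i, (forall u, U u -> derivable f u (evec i)) /\ Ck k' U (partial i f)
  else True.

Definition smooth_on (U : set 'rV[R]_n) (f : 'rV[R]_n -> R) : Prop :=
  forall k, Ck k U f.

Definition smooth_mx p q (U : set 'rV[R]_n) (F : 'rV[R]_n -> 'M[R]_(p, q)) :
    Prop :=
  forall a b, smooth_on U (fun u => F u a b).

End Smooth.

(* Smooth n-manifolds, presented by an atlas. *)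
Record manifold (R : realType) (n : nat) := Manifold {
  pt :> topologicalType;
  pt_hausdorff : hausdorff_space pt;
  pt_second_countable : @second_countable pt;
  chart : Type;
  dom : chart -> set pt;
  coord : chart -> pt -> 'rV[R]_n;
  param : chart -> 'rV[R]_n -> pt;
  dom_open : forall i, open (dom i);
  dom_cover : forall p, exists i, dom i p;
  img_open : forall i, open (coord i @` dom i);
  coordK : forall i p, dom i p -> param i (coord i p) = p;
  coord_continuous : forall i p, dom i p -> {for p, continuous (coord i)};
  param_continuous : forall i u, (coord i @` dom i) u ->
    {for u, continuous (param i)};
  transition_smooth : forall i j,
    smooth_mx (coord i @` (dom i `&` dom j)) (coord j \o param i)
}.

Section Fields.
Context (R : realType) (n : nat) (M : manifold R n).

Definition cimg (i : chart M) : set 'rV[R]_n := coord i @` dom i.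

Definition overlap (i j : chart M) : set 'rV[R]_n :=
  coord i @` (dom i `&` dom j).

Definition transition (i j : chart M) : 'rV[R]_n -> 'rV[R]_n :=
  coord j \o param i.

(* A smooth tensor field is given by its components in every chart, subject to
   the tensor transformation law on overlaps. *)
Record vectorField := VectorField {
  vf :> chart M -> 'rV[R]_n -> 'rV[R]_n;
  vf_smooth : forall i, smooth_mx (cimg i) (vf i);
  vf_compat : forall i j u, overlap i j u ->
    vf j (transition i j u) = vf i u *m 'J (transition i j) u
}.

Record oneForm := OneForm {
  oform :> chart M -> 'rV[R]_n -> 'cV[R]_n;
  oform_smooth : forall i, smooth_mx (cimg i) (oform i);
  oform_compat : forall i j u, overlap i j u ->
    oform i u = 'J (transition i j) u *m oform j (transition i j u)
}.

Record endoField := EndoField {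
  ef :> chart M -> 'rV[R]_n -> 'M[R]_n;
  ef_smooth : forall i, smooth_mx (cimg i) (ef i);
  ef_compat : forall i j u, overlap i j u ->
    'J (transition i j) u *m ef j (transition i j u) =
    ef i u *m 'J (transition i j) u
}.

(* By Sylvester's law, the symmetric matrix G is nondegenerate of index nu
   (for nu <= n). *)
Definition has_index (G : 'M[R]_n) (nu : nat) : Prop :=
  exists2 P, P \in unitmx &
    P *m G *m P^T = diag_mx (\row_(k < n) (if (k < nu)%N then -1 else 1)).

Record semiRiemannianMetric := SemiRiemannianMetric {
  met :> chart M -> 'rV[R]_n -> 'M[R]_n;
  met_smooth : forall i, smooth_mx (cimg i) (met i);
  met_compat : forall i j u, overlap i j u ->
    met i u = 'J (transition i j) u *m met j (transition i j u)
              *m ('J (transition i j) u)^T;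
  met_sym : forall i u, cimg i u -> (met i u)^T = met i u;
  met_index : exists2 nu : nat, (nu <= n)%N &
    forall i u, cimg i u -> has_index (met i u) nu
}.

End Fields.

(* Semi-Riemannian geometry in one chart: G is the matrix of the metric as a
   function of the coordinates, and vector fields are maps 'rV_n -> 'rV_n. *)
Section Chart.
Context (R : realType) (n : nat).
Implicit Types (G : 'rV[R]_n -> 'M[R]_n) (X Y W : 'rV[R]_n -> 'rV[R]_n).
Implicit Types (u x y w a b : 'rV[R]_n) (T g : 'rV[R]_n -> 'rV[R]_n -> R).

Definition form_of (A : 'M[R]_n) x y : R := (x *m A *m y^T) 0 0.

(* Gamma^k_ij of the Levi-Civita connection of G. *)
Definition christoffel G u (i j k : 'I_n) : R :=
  2^-1 * \sum_l (partial i (fun v => G v j l) u + partial j (fun v => G v i l) u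
                 - partial l (fun v => G v i j) u) * invmx (G u) l k.

Definition dirder X Y : 'rV[R]_n -> 'rV[R]_n :=
  fun u => \row_k 'D_(X u) (fun v => Y v 0 k) u.

Definition bracket X Y : 'rV[R]_n -> 'rV[R]_n :=
  fun u => dirder X Y u - dirder Y X u.

(* The Levi-Civita covariant derivative nabla_X Y. *)
Definition nabla G X Y : 'rV[R]_n -> 'rV[R]_n :=
  fun u => dirder X Y u
    + \row_k \sum_i \sum_j X u 0 i * Y u 0 j * christoffel G u i j k.

(* (nabla_X F) Y for a (1,1)-tensor field F. *)
Definition nabla_endo G (F : 'rV[R]_n -> 'M[R]_n) X Y : 'rV[R]_n -> 'rV[R]_n :=
  fun u => nabla G X (fun v => Y v *m F v) u - nabla G X Y u *m F u.

Definition curvature G X Y W : 'rV[R]_n -> 'rV[R]_n :=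
  fun u => nabla G X (nabla G Y W) u - nabla G Y (nabla G X W) u
           - nabla G (bracket X Y) W u.

(* R(x,y)w for tangent vectors at u: the curvature being tensorial, any
   extension of x, y, w to vector fields may be used. *)
Definition curv_at G u x y w : 'rV[R]_n :=
  curvature G (fun=> x) (fun=> y) (fun=> w) u.

Definition ricci G u y w : R := \tr (lin1_mx (fun x => curv_at G u x y w)).

Definition wedge g x y w : 'rV[R]_n := g y w *: x - g x w *: y.

(* (R(x,y).T)(a,b) *)
Definition curv_dot G u T x y a b : R :=
  - T (curv_at G u x y a) b - T a (curv_at G u x y b).

(* Q(g,T)(a,b;x,y) *)
Definition tachibana g T a b x y : R :=
  - T (wedge g x y a) b - T a (wedge g x y b).

End Chart.

Section ParaSasakian.
Context (R : realType) (n : nat) (M : manifold R n).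
Implicit Types (phi : endoField M) (xi : vectorField M) (eta : oneForm M).
Implicit Types (g : semiRiemannianMetric M) (psi L : M -> R) (p : M).

Definition metric_at g (i : chart M) p : 'rV[R]_n -> 'rV[R]_n -> R :=
  form_of (g i (coord i p)).

Definition ricci_at g (i : chart M) p : 'rV[R]_n -> 'rV[R]_n -> R :=
  ricci (g i) (coord i p).

Definition almost_paracontact phi xi eta : Prop :=
  forall i u, cimg i u ->
  [/\ phi i u *m phi i u = 1%:M - eta i u *m xi i u,
      xi i u *m eta i u = 1%:M,
      xi i u *m phi i u = 0 &
      phi i u *m eta i u = 0].

Definition almost_paracontact_metric (eps : R) phi xi eta g : Prop :=
  [/\ eps = 1 \/ eps = -1,
      almost_paracontact phi xi eta &
      forall i u, cimg i u -> forall x y,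
        form_of (g i u) (x *m phi i u) (y *m phi i u) =
        form_of (g i u) x y
        - eps * (x *m eta i u) 0 0 * (y *m eta i u) 0 0].

(* X and Y range over the smooth vector fields on each chart domain. *)
Definition para_sasakian (eps : R) phi xi eta g : Prop :=
  almost_paracontact_metric eps phi xi eta g /\
  forall i (X Y : 'rV[R]_n -> 'rV[R]_n),
    smooth_mx (cimg i) X -> smooth_mx (cimg i) Y ->
    forall u, cimg i u ->
      nabla_endo (g i) (phi i) X Y u =
      - (form_of (g i u) (X u *m phi i u) (Y u *m phi i u) *: xi i u)
      - (eps * (Y u *m eta i u) 0 0) *: (X u *m phi i u *m phi i u).

Definition Ztensor g psi (i : chart M) p : 'rV[R]_n -> 'rV[R]_n -> R :=
  fun x y => ricci_at g i p x y + psi p * metric_at g i p x y.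

(* The set of points at which the Z tensor does not vanish. *)
Definition UZ g psi : set M :=
  [set p | exists2 i, dom i p & exists x y, Ztensor g psi i p x y != 0].

(* Z-pseudosymmetry with associated function L; only the values of L on UZ
   are constrained. *)
Definition Z_pseudosymmetric g psi L : Prop :=
  forall p, UZ g psi p -> forall i, dom i p -> forall x y a b,
    curv_dot (g i) (coord i p) (Ztensor g psi i p) x y a b =
    L p * tachibana (metric_at g i p) (Ztensor g psi i p) a b x y.

(* S = lam g at the point p.  M is Einstein when this holds at every p for one
   constant lam.  Where Z is a multiple of g, both sides of the pseudosymmetry
   equation vanish and L is unconstrained; the alternative "Einstein or
   L = - eps" is therefore formulated point by point, with a single lam. *)
Definition einstein_at g (lam : R) p : Prop :=
  forall i, dom i p -> forall x y,
    ricci_at g i p x y = lam * metric_at g i p x y.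

End ParaSasakian.

(* Main.v *)
Require Import Defs.
From mathcomp Require Import all_boot all_order all_algebra.
From mathcomp Require Import all_classical all_reals all_analysis.
From mathcomp Require Import ring lra.
Import GRing.Theory Num.Theory.
Import Order.TTheory numFieldNormedType.Exports.
Local Open Scope classical_set_scope.
Local Open Scope ring_scope.
Set Implicit Arguments.
Unset Strict Implicit.
Unset Printing Implicit Defensive.

(** In dimension [n] the constant is [lam = (1 - n) eps], and the argument is
pointwise.  Two facts about a para-Sasakian structure carry it:
[R(x, y) xi = eta(x) y - eta(y) x] ([xi_curvature_form]) and its trace
[S(y, xi) = (1 - n) eta(y)] ([ricci_xi]).  The first one compares with the wedge,
[R(x, y) xi = - eps (x /\ y) xi], because [eta = eps g(., xi)].  The second one says
that [T = Z - kappa g], for a suitable scalar [kappa], vanishes when its second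
argument is [xi]; moreover [T = S - lam g].  Neither side of the pseudosymmetry
equation sees the multiple [kappa g], so the equation holds for [T]; evaluated with
[xi] in the last slot it reads [T(a, R(x, y) xi) = L T(a, (x /\ y) xi)], and [y = xi]
turns this into [(L + eps) T(a, x) = 0] ([pseudosymmetric_chart]).  Hence [L = - eps]
wherever [S] differs from [lam g], and such a point lies in the set where [Z] is
nonzero by [vanishing_Z_ricci].

The two facts are derived in a chart from the connection matrix Omega_x, for which
[nabla_x Y = D_x Y + Y Omega_x].  The curvature is then right multiplication by a
matrix K(x, y) for every smooth field ([curvatureE]), so [R(x, y) xi] may be computed
with the field [xi] although the curvature at a point is defined through constant
extensions, and K is skew for the metric ([curvature_form_skew]), which is the
invariance of [g] under [R] used above.  Both rest on the symmetry of second
derivatives ([smooth_schwarz]).  Smoothness is given as the existence and continuity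
of iterated partial derivatives, so the symmetry, and the directional derivatives in
arbitrary directions ([smooth_is_derive]), are obtained from the mean value
theorem. *)

(** * Directional derivatives of scalar functions *)

Section Directional.
Context (R : realType) (V : normedModType R).
Implicit Types (f : V -> R) (u v w a b p : V).

(** Differentiating in the direction [v] along the line through [p] is ordinary
differentiation in the parameter, which gives access to the mean value theorem. *)
Lemma is_derive_lineP f p v (t df : R) :
  is_derive (p + t *: v) v f df <->
  is_derive t 1 (fun s : R => f (p + s *: v)) df.
Proof.
have E : (fun h : R => h^-1 *: (((fun s : R => f (p + s *: v)) \o shift t) (h *: (1 : R))
    - f (p + t *: v))) =
  (fun h : R => h^-1 *: ((f \o shift (p + t *: v)) (h *: v) - f (p + t *: v))).
  apply/funext => h /=; congr (_ *: (f _ - _)).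
  by rewrite [h *: 1]mulr1 scalerDl addrCA.
by split=> -[D <-]; split; move: D; rewrite /derivable /derive E.
Qed.

Lemma mean_value_line f (df : V -> R) p v :
  (forall t : R, 0 <= t <= 1 -> is_derive (p + t *: v) v f (df (p + t *: v))) ->
  exists2 t : R, 0 <= t <= 1 & f (p + v) - f p = df (p + t *: v).
Proof.
move=> D.
have Dl (t : R) : 0 <= t <= 1 ->
    is_derive t 1 (fun s : R => f (p + s *: v)) (df (p + t *: v)).
  by move=> /D /is_derive_lineP.
have [t| |t t01] := @MVT_segment R (fun s : R => f (p + s *: v))
  (fun t : R => df (p + t *: v)) 0 1 ler01.
- by rewrite in_itv /= => /andP[t0 t1]; apply: Dl; rewrite !ltW.
- apply: derivable_within_continuous => t; rewrite in_itv /= => t01.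
  by have [] := Dl t t01.
- rewrite scale1r scale0r addr0 subr0 mulr1 => E.
  by exists t => //; move: t01; rewrite in_itv.
Qed.

Lemma is_derive_scale_dir f u v (c df : R) :
  is_derive u v f df -> is_derive u (c *: v) f (c * df).
Proof.
move=> D; rewrite -[u]addr0 -(scale0r (c *: v)); apply/is_derive_lineP.
have D0 : is_derive (c *: (0 : R)) 1 (fun s : R => f (u + s *: v)) df.
  by apply/is_derive_lineP; rewrite scaler0 scale0r addr0.
have Dc : is_derive (0 : R) 1 ( *:%R c) c by apply: is_derive_eq; rewrite [LHS]mulr1.
have := is_derive1_comp D0 Dc; rewrite mulrC /comp.
congr (is_derive _ _ _ _); apply/funext => s.
by rewrite scalerA mulrC.
Qed.

Lemma near_parallelogram u a b (A : set V) : nbhs u A ->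
  \forall h \near (0 : R), forall s t : R, 0 <= s <= 1 -> 0 <= t <= 1 ->
    A (u + s *: (h *: a) + t *: (h *: b)).
Proof.
move=> /nbhs_ballP[e /= e0 eA].
have c0 : 0 < `|a| + `|b| + 1 by rewrite ltr_wpDl// addr_ge0.
near=> h => s t /andP[s0 s1] /andP[t0 t1]; apply: eA.
rewrite -ball_normE /= opprD addrA opprD addrA subrr add0r -opprD normrN.
apply: (@le_lt_trans _ _ (`|h| * (`|a| + `|b| + 1))).
  rewrite (le_trans (ler_normD _ _))// !normrZ !(ger0_norm s0) !(ger0_norm t0).
  rewrite !mulrDr mulr1 (@le_trans _ _ (`|h| * `|a| + `|h| * `|b|)) ?lerDl//.
  by apply: lerD; rewrite ler_piMl ?mulr_ge0.
rewrite -ltr_pdivlMr//.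
near: h; apply: (@nbhs0_lt R R); exact: divr_gt0.
Unshelve. all: by end_near. Qed.

(** Walk from [u] along [h a] and then along [h b].  The first leg contributes the
derivative at [u]; the mean value theorem evaluates [df] on the second leg, which
shrinks to [u], so continuity of [df] at [u] alone suffices. *)
Lemma is_derive_add_dir f (df : V -> R) u a b (da : R) :
  is_derive u a f da -> (\forall w \near u, is_derive w b f (df w)) ->
  {for u, continuous df} -> is_derive u (a + b) f (da + df u).
Proof.
move=> [Da <-] Db Cb.
pose q := fun h : R => h^-1 *: (f (u + h *: a + h *: b) - f (u + h *: a)).
have cvga : h^-1 *: (f (u + h *: a) - f u) @[h --> 0^'] --> 'D_a f u.
  by under eq_fun do rewrite [u + _]addrC; exact: Da.
have cvgb : q h @[h --> 0^'] --> df u.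
  apply/cvgrPdist_lt => e e0.
  have /cvgrPdist_lt/(_ _ e0) Ce := Cb.
  have H := nbhs_dnbhs (near_parallelogram a b (filterI Db Ce)).
  near=> h.
  have h0 : h != 0 by near: h; exact: nbhs_dnbhs_neq.
  have P : forall s t : R, 0 <= s <= 1 -> 0 <= t <= 1 ->
    is_derive (u + s *: (h *: a) + t *: (h *: b)) b f
      (df (u + s *: (h *: a) + t *: (h *: b))) /\
    `|df u - df (u + s *: (h *: a) + t *: (h *: b))| < e.
    by near: h; exact: H.
  have [|t t01 E] := @mean_value_line f (fun w => h * df w)
      (u + h *: a) (h *: b).
    move=> t t01; apply: is_derive_scale_dir.
    by rewrite -[h *: a]scale1r; apply: (P _ _ _ _).1 => //; rewrite lexx ler01.
  rewrite /q E -[_ *: _]/(_ * _) mulKf//.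
  by rewrite -[h *: a]scale1r; apply: (P _ _ _ _).2 => //; rewrite lexx ler01.
have cvgab : h^-1 *: ((f \o shift u) (h *: (a + b)) - f u) @[h --> 0^'] -->
    'D_a f u + df u.
  rewrite ['D_a f u + _]addrC; apply: cvg_trans (cvgD cvgb cvga); apply: near_eq_cvg.
  near=> h; rewrite /q fctE /= -scalerDr; congr (_ *: _).
  have sub_telescope (x y z : R) : x - y + (y - z) = x - z by rewrite addrA subrK.
  by rewrite [LHS]sub_telescope scalerDr [_ + u]addrC addrA.
by split; [apply/cvg_ex; exists ('D_a f u + df u)|exact/cvg_lim].
Unshelve. all: by end_near. Qed.

(** The mean value theorem, applied in the direction [a] to the increment of [f]
over [h b] and then in the direction [b] to ['D_a f], turns the second difference
into [h ^+ 2] times a mixed derivative at a point of the parallelogram. *)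
Lemma second_difference_cvg f u a b :
  (\forall w \near u, derivable f w a /\ derivable ('D_a f) w b) ->
  {for u, continuous ('D_b ('D_a f))} ->
  (h ^+ 2)^-1 * (f (u + h *: a + h *: b) - f (u + h *: a)
    - (f (u + h *: b) - f u)) @[h --> 0^'] --> 'D_b ('D_a f) u.
Proof.
move=> D C; apply/cvgrPdist_lt => e e0.
have /cvgrPdist_lt/(_ _ e0) Ce := C.
have H := nbhs_dnbhs (near_parallelogram a b (filterI D Ce)).
near=> h.
have h0 : h != 0 by near: h; exact: nbhs_dnbhs_neq.
have P : forall s t : R, 0 <= s <= 1 -> 0 <= t <= 1 ->
  (derivable f (u + s *: (h *: a) + t *: (h *: b)) a /\
   derivable ('D_a f) (u + s *: (h *: a) + t *: (h *: b)) b) /\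
  `|'D_b ('D_a f) u - 'D_b ('D_a f) (u + s *: (h *: a) + t *: (h *: b))| < e.
  by near: h; exact: H.
have i0 : 0 <= (0 : R) <= 1 by rewrite lexx ler01.
have i1 : 0 <= (1 : R) <= 1 by rewrite lexx ler01.
pose F := fun w => f (w + h *: b) - f w.
have [|s s01 E1] := @mean_value_line F
    (fun w => h * 'D_a f (w + h *: b) - h * 'D_a f w) u (h *: a).
  move=> s s01.
  have := (P s 1 s01 i1).1.1; have := (P s 0 s01 i0).1.1.
  rewrite scale1r scale0r addr0 => D0 D1.
  apply: is_deriveB; last exact/is_derive_scale_dir/derivableP.
  apply/is_derive_lineP; under eq_fun do rewrite addrAC.
  by apply/is_derive_lineP; rewrite addrAC; exact/is_derive_scale_dir/derivableP.
have [|t t01 E2] := @mean_value_line ('D_a f) (fun w => h * 'D_b ('D_a f) w)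
    (u + s *: (h *: a)) (h *: b).
  by move=> t t01; apply/is_derive_scale_dir/derivableP; exact: (P _ _ _ _).1.2.
rewrite -[X in _ * X]/(F (u + h *: a) - F u) E1 -mulrBr E2.
rewrite [h * (h * _)]mulrA -expr2 mulKf ?expf_neq0//.
exact: (P _ _ _ _).2.
Unshelve. all: by end_near. Qed.

(** The second difference is symmetric in [a] and [b], and both mixed derivatives
are limits of it. *)
Lemma schwarz f u a b :
  (\forall w \near u, [/\ derivable f w a, derivable f w b,
    derivable ('D_a f) w b & derivable ('D_b f) w a]) ->
  {for u, continuous ('D_b ('D_a f))} -> {for u, continuous ('D_a ('D_b f))} ->
  'D_b ('D_a f) u = 'D_a ('D_b f) u.
Proof.
move=> D Cab Cba.
have Dab : \forall w \near u, derivable f w a /\ derivable ('D_a f) w b.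
  by apply: filterS D => w [].
have Dba : \forall w \near u, derivable f w b /\ derivable ('D_b f) w a.
  by apply: filterS D => w [].
have H := second_difference_cvg Dab Cab.
have H' := second_difference_cvg Dba Cba.
set d := (X in X @ _ --> _) in H; set d' := (X in X @ _ --> _) in H'.
have dd' : d = d'.
  by apply/funext => h; rewrite /d /d' [u + h *: b + _]addrAC; congr (_ * _); ring.
by rewrite -(cvg_lim _ H)// dd' (cvg_lim _ H').
Qed.

End Directional.

(** * Smooth functions on an open set *)

Section SmoothFunctions.
Context (R : realType) (n : nat) (U : set 'rV[R]_n) (Uo : open U).
Implicit Types (f : 'rV[R]_n -> R) (u v w : 'rV[R]_n).

Lemma smooth_continuous f u : smooth_on U f -> U u -> {for u, continuous f}.
Proof. by move=> /(_ 0%N)[+ _]; apply. Qed.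

Lemma smooth_cst (c : R) : smooth_on U (fun=> c).
Proof.
move=> k; elim: k c => [|k IHk] c; split=> //.
- by move=> u _; exact: cst_continuous.
- by move=> u _; exact: cst_continuous.
move=> i; split=> [u _|]; first exact: derivable_cst.
rewrite (_ : partial i _ = fun=> 0); first exact: IHk.
by apply/funext => u; exact: derive_cst.
Qed.

Lemma smooth_mx_cst p q (x : 'M[R]_(p, q)) : smooth_mx U (fun=> x).
Proof. by move=> i j; exact: smooth_cst. Qed.

Lemma smooth_partial f i : smooth_on U f -> smooth_on U (partial i f).
Proof. by move=> sf k; have [_ /(_ i)[]] := sf k.+1. Qed.

(** Continuous partial derivatives give every directional derivative: add the
coordinate directions of [v] one at a time. *)
Lemma smooth_is_derive f u v : smooth_on U f -> U u ->
  is_derive u v f (\sum_i v 0 i * partial i f u).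
Proof.
move=> sf Uu; rewrite [X in is_derive u X](row_sum_delta v).
elim: index_enum => [|i s IHs]; first by rewrite !big_nil; exact: is_derive0.
rewrite !big_cons [X in is_derive u X]addrC [X in is_derive u _ f X]addrC.
apply: (is_derive_add_dir (df := fun w => v 0 i * partial i f w)) => //.
  near=> w; apply/is_derive_scale_dir/derivableP.
  have [_ /(_ i)[+ _]] := sf 1%N; apply.
  by near: w; exact: open_nbhs_nbhs.
exact: cvgMr (smooth_continuous (smooth_partial i sf) Uu).
Unshelve. all: by end_near. Qed.

Lemma smooth_derivable f u v : smooth_on U f -> U u -> derivable f u v.
Proof. by move=> sf Uu; have [] := smooth_is_derive v sf Uu. Qed.

Lemma is_derive2_smooth f u v w : smooth_on U f -> U u ->
  is_derive u w ('D_v f)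
    (\sum_i \sum_j v 0 i * (w 0 j * partial j (partial i f) u)).
Proof.
move=> sf Uu.
apply: (@near_eq_is_derive _ _ _ (\sum_i (fun x => v 0 i * partial i f x))).
  near=> x; rewrite fct_sumE; apply/esym.
  have Ux : U x by near: x; exact: open_nbhs_nbhs.
  by have [_ ->] := smooth_is_derive v sf Ux.
apply: is_derive_sum => i; rewrite -mulr_sumr.
have := smooth_is_derive w (smooth_partial i sf) Uu.
exact: is_deriveZ.
Unshelve. all: by end_near. Qed.

Lemma smooth_schwarz f u v w : smooth_on U f -> U u ->
  'D_w ('D_v f) u = 'D_v ('D_w f) u.
Proof.
move=> sf Uu.
have [_ ->] := is_derive2_smooth v w sf Uu.
have [_ ->] := is_derive2_smooth w v sf Uu.
rewrite exchange_big; apply: eq_bigr => i _; apply: eq_bigr => j _.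
have -> : partial i (partial j f) u = partial j (partial i f) u.
  apply: (@schwarz _ _ f u (evec R j) (evec R i)).
  - near=> x; have Ux : U x by near: x; exact: open_nbhs_nbhs.
    by split; apply: smooth_derivable => //; apply: smooth_partial.
  - exact: (smooth_continuous (smooth_partial i (smooth_partial j sf)) Uu).
  - exact: (smooth_continuous (smooth_partial j (smooth_partial i sf)) Uu).
exact: mulrCA.
Unshelve. all: by end_near. Qed.

End SmoothFunctions.

(** * Derivatives of matrix-valued functions *)

Section MatrixCalculus.
Context (R : realType) (V : normedModType R).
Implicit Types (u v : V).

Lemma is_derive_mxP m p (F : V -> 'M[R]_(m, p)) u v (dF : 'M[R]_(m, p)) :
  is_derive u v F dF <->
  forall i j, is_derive u v (fun w => F w i j) (dF i j).
Proof.
split=> [[D <-] i j|D].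
  by split; [move: i j; exact/derivable_mxP|rewrite derive_mx// mxE].
have DF : derivable F u v by apply/derivable_mxP => i j; have [] := D i j.
split=> //; rewrite derive_mx//; apply/matrixP => i j; rewrite mxE.
by have [] := D i j.
Qed.

Lemma is_derive_mulmx m p q (F : V -> 'M[R]_(m, p)) (G : V -> 'M[R]_(p, q))
    u v dF dG :
  is_derive u v F dF -> is_derive u v G dG ->
  is_derive u v (fun w => F w *m G w) (dF *m G u + F u *m dG).
Proof.
move=> /is_derive_mxP DF /is_derive_mxP DG; apply/is_derive_mxP => i j.
have -> : (fun w => (F w *m G w) i j) =
    \sum_k (fun w => F w i k) * (fun w => G w k j).
  by apply/funext => w; rewrite mxE fct_sumE.
rewrite !mxE -big_split /=; apply: is_derive_sum => k.
apply: is_derive_eq (is_deriveM (DF i k) (DG k j)) _.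
by rewrite addrC [G u k j *: _]mulrC.
Qed.

Lemma is_derive_trmx m p (F : V -> 'M[R]_(m, p)) u v dF :
  is_derive u v F dF -> is_derive u v (fun w => (F w)^T) dF^T.
Proof.
move=> /is_derive_mxP DF; apply/is_derive_mxP => i j.
by rewrite mxE; under eq_fun do rewrite mxE.
Qed.

Lemma derivable_bigsum (I : Type) (r : seq I) (F : I -> V -> R) u v :
  (forall i, derivable (F i) u v) ->
  derivable (fun w => \sum_(i <- r) F i w) u v.
Proof.
move=> DF; elim: r => [|i r IHr].
  by under eq_fun do rewrite big_nil; exact: derivable_cst.
rewrite (_ : (fun _ => _) = F i + (fun w => \sum_(j <- r) F j w)).
  exact: derivableD (DF i) IHr.
by apply/funext => w; rewrite big_cons.
Qed.

Lemma derivable_bigprod (I : Type) (r : seq I) (F : I -> V -> R) u v :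
  (forall i, derivable (F i) u v) ->
  derivable (fun w => \prod_(i <- r) F i w) u v.
Proof.
move=> DF; elim: r => [|i r IHr].
  by under eq_fun do rewrite big_nil; exact: derivable_cst.
rewrite (_ : (fun _ => _) = F i * (fun w => \prod_(j <- r) F j w)).
  exact: derivableM (DF i) IHr.
by apply/funext => w; rewrite big_cons.
Qed.

Lemma derivable_det m (F : V -> 'M[R]_m) u v :
  derivable F u v -> derivable (fun w => \det (F w)) u v.
Proof.
move=> /derivable_mxP DF; apply: derivable_bigsum => s.
by apply: derivableM; [exact: derivable_cst|exact: derivable_bigprod].
Qed.

(** Cramer's rule. *)
Lemma derivable_invmx m (F : V -> 'M[R]_m) u v :
  (\forall w \near u, F w \in unitmx) ->
  derivable F u v -> derivable (fun w => invmx (F w)) u v.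
Proof.
move=> unitF DF; have unitFu := nbhs_singleton unitF.
apply: (@near_eq_derivable _ _ _ (fun w => (\det (F w))^-1 *: \adj (F w))).
  by apply: filterS unitF => w unitFw; rewrite /invmx unitFw.
apply/derivable_mxP => i j; under eq_fun do rewrite !mxE.
apply: derivableM.
  apply: derivableV; last exact: derivable_det.
  by move: unitFu; rewrite unitmxE unitfE.
apply: derivableM; first exact: derivable_cst.
apply: derivable_det; apply/derivable_mxP => k l; under eq_fun do rewrite !mxE.
by have /derivable_mxP := DF; apply.
Qed.

End MatrixCalculus.

(** * Noncommutative matrix identities *)

(** The two sides of the Ricci identity for a section [w] along commuting fields
[x], [y]: [p], [q] are its first derivatives, [h] the common value of its mixed
second derivatives, [a], [b] the connection matrices in the directions [x] and
[y], and [dxb], [dya] their crossed derivatives. *)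
Lemma curvature_expansion (R : comNzRingType) n (h p q w : 'rV[R]_n)
    (a b dxb dya : 'M[R]_n) :
  h + (p *m b + w *m dxb) + (q + w *m b) *m a
  - (h + (q *m a + w *m dya) + (p + w *m a) *m b) =
  w *m (dxb - dya + b *m a - a *m b).
Proof.
rewrite !mulmxDl !mulmxDr !mulmxN !mulmxA.
move: (p *m b) (q *m a) (w *m dxb) (w *m dya) (w *m b *m a) (w *m a *m b).
by move=> *; apply/rowP => k; rewrite !mxE; ring.
Qed.

(** The hypothesis is the symmetry of the second derivatives of the metric [s],
each written by differentiating [dx s = a s + s a^T]; the mixed terms
[a s b^T] and [b s a^T] occur on both sides and cancel. *)
Lemma skew_expansion (R : comNzRingType) n (s a b dxb dya : 'M[R]_n) :
  dxb *m s + b *m (a *m s + s *m a^T)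
  + ((a *m s + s *m a^T) *m b^T + s *m dxb^T) =
  dya *m s + a *m (b *m s + s *m b^T)
  + ((b *m s + s *m b^T) *m a^T + s *m dya^T) ->
  (dxb - dya + b *m a - a *m b) *m s
  + s *m (dxb - dya + b *m a - a *m b)^T = 0.
Proof.
have trD (A B : 'M[R]_n) : (A + B)^T = A^T + B^T.
  by apply/matrixP => i j; rewrite !mxE.
have trN (A : 'M[R]_n) : (- A)^T = - A^T by apply/matrixP => i j; rewrite !mxE.
rewrite !trD !trN !trmx_mul !mulmxDl !mulmxDr !mulNmx !mulmxN !mulmxA.
move: (dxb *m s) (dya *m s) (s *m dxb^T) (s *m dya^T) (b *m a *m s) (a *m b *m s)
  (s *m a^T *m b^T) (s *m b^T *m a^T) (b *m s *m a^T) (a *m s *m b^T).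
move=> m1 m2 m3 m4 m5 m6 m7 m8 m9 m10 /matrixP E.
apply/matrixP => i j; move/eqP: (E i j); rewrite -subr_eq0 !mxE => /eqP <-.
by ring.
Qed.

(** The derivative of [x g x^T] when the derivative of the metric [g] is
[w g + g w^T]: the bracket [d + x w] is the covariant derivative of [x]. *)
Lemma norm_expansion (R : comNzRingType) n (d x : 'rV[R]_n) (g w : 'M[R]_n) :
  g^T = g ->
  (d + x *m w) *m g *m x^T + ((d + x *m w) *m g *m x^T)^T =
  (d *m g + x *m (w *m g + g *m w^T)) *m x^T + x *m g *m d^T.
Proof.
move=> symg; rewrite !trmx_mul trmxK symg.
have -> : (d + x *m w)^T = d^T + w^T *m x^T.
  by rewrite -trmx_mul; apply/matrixP => i j; rewrite !mxE.
rewrite !mulmxDl !mulmxDr !mulmxDl !mulmxA.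
move: (d *m g *m x^T) (x *m w *m g *m x^T) (x *m g *m d^T)
  (x *m g *m w^T *m x^T).
by move=> *; apply/matrixP => i j; rewrite !mxE; ring.
Qed.

(** * The Levi-Civita connection as a matrix of one-forms *)

Section Connection.
Context (R : realType) (n : nat).
Implicit Types (G : 'rV[R]_n -> 'M[R]_n) (X Y W : 'rV[R]_n -> 'rV[R]_n).
Implicit Types (u x y w : 'rV[R]_n).

(** The Christoffel symbols of the first kind. *)
Definition lower_christoffel G u (i j l : 'I_n) : R :=
  2^-1 * (partial i (fun v => G v j l) u + partial j (fun v => G v i l) u
          - partial l (fun v => G v i j) u).

Definition lower_connection G x u : 'M[R]_n :=
  \matrix_(j, l) \sum_i x 0 i * lower_christoffel G u i j l.

(** The matrix Omega_x for which the covariant derivative of [Y] in the direction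
[x] is [D_x Y + Y Omega_x]. *)
Definition connection G x u : 'M[R]_n :=
  lower_connection G x u *m invmx (G u).

Lemma dirderE X Y u (dY : 'rV[R]_n) : is_derive u (X u) Y dY ->
  dirder X Y u = dY.
Proof.
by move=> /is_derive_mxP DY; apply/rowP => k; rewrite mxE; have [] := DY 0 k.
Qed.

Lemma dirder_cst x y u : dirder (fun=> x) (fun=> y) u = 0 :> 'rV[R]_n.
Proof. by apply/rowP => k; rewrite !mxE derive_cst. Qed.

Lemma nablaE G X Y u :
  nabla G X Y u = dirder X Y u + Y u *m connection G (X u) u.
Proof.
rewrite /nabla; congr (_ + _); rewrite mulmxA.
apply/rowP => k; rewrite !mxE exchange_big /=.
rewrite [RHS](eq_bigr (fun l => \sum_j \sum_i
    X u 0 i * Y u 0 j * lower_christoffel G u i j l * invmx (G u) l k)).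
  rewrite [RHS]exchange_big /=; apply: eq_bigr => j _.
  rewrite [RHS]exchange_big /=; apply: eq_bigr => i _.
  rewrite /christoffel !mulr_sumr; apply: eq_bigr => l _.
  by rewrite /lower_christoffel !mulrA.
move=> l _; rewrite !mxE mulr_suml; apply: eq_bigr => j _.
rewrite mxE mulr_sumr mulr_suml; apply: eq_bigr => i _.
by rewrite !mulrA [Y u 0 j * _]mulrC.
Qed.

Lemma nabla_near_eq G X Y Y' u : (\forall w \near u, Y w = Y' w) ->
  nabla G X Y u = nabla G X Y' u.
Proof.
move=> YY'; rewrite /nabla (nbhs_singleton YY'); congr (_ + _).
apply/rowP => k; rewrite !mxE; apply: near_eq_derive.
by apply: filterS YY' => w ->.
Qed.

Lemma form_ofB (A : 'M[R]_n) a c d v w :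
  form_of A a (c *: v - d *: w) = c * form_of A a v - d * form_of A a w.
Proof.
have trB : (c *: v - d *: w)^T = c *: v^T - d *: w^T.
  by apply/matrixP => i j; rewrite !mxE.
rewrite /form_of trB mulmxBr -!scalemxAr.
by move: (_ *m v^T) (_ *m w^T) => s t; rewrite !mxE.
Qed.

Lemma connection0 G u : connection G 0 u = 0.
Proof.
rewrite /connection (_ : lower_connection _ _ _ = 0) ?mul0mx//.
by apply/matrixP => j l; rewrite !mxE big1// => i _; rewrite mxE mul0r.
Qed.

(** Constant coordinate fields commute, so the bracket term of the curvature drops
out. *)
Lemma nabla_bracket_cst G W u x y :
  nabla G (bracket (fun=> x) (fun=> y)) W u = 0.
Proof.
have -> : bracket (fun=> x) (fun=> y) = fun=> 0.
  apply/funext => w; rewrite /bracket /dirder.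
  by apply/rowP => k; rewrite !mxE !derive_cst subrr.
have D0 : is_derive u ((fun=> 0) u) W 0 by exact: is_derive0.
by rewrite nablaE (dirderE D0) connection0 mulmx0 addr0.
Qed.

End Connection.

(** * The curvature matrix and its symmetries *)

Section Curvature.
Context (R : realType) (n : nat) (U : set 'rV[R]_n) (Uo : open U).
Context (G : 'rV[R]_n -> 'M[R]_n) (smG : smooth_mx U G).
Hypothesis symG : forall u, U u -> (G u)^T = G u.
Hypothesis unitG : forall u, U u -> G u \in unitmx.
Implicit Types (W : 'rV[R]_n -> 'rV[R]_n) (u x y w : 'rV[R]_n).

Lemma near_open u : U u -> \forall w \near u, U w.
Proof. by move=> Uu; apply: open_nbhs_nbhs. Qed.

Lemma smooth_mx_derivable p q (F : 'rV[R]_n -> 'M[R]_(p, q)) u x :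
  smooth_mx U F -> U u -> derivable F u x.
Proof.
move=> sF Uu; apply/derivable_mxP => i j.
exact: (smooth_derivable Uo (sF i j) Uu).
Qed.

Lemma partial_metric_sym u (k i j : 'I_n) : U u ->
  partial k (fun v => G v i j) u = partial k (fun v => G v j i) u.
Proof.
move=> Uu; apply: near_eq_derive; apply: filterS (near_open Uu) => w Uw.
by rewrite -[in LHS]symG// mxE.
Qed.

Lemma derivable_connection x u v : U u -> derivable (connection G x) u v.
Proof.
move=> Uu.
have Dlow : derivable (lower_connection G x) u v.
  apply/derivable_mxP => j l; under eq_fun do rewrite mxE.
  apply: derivable_bigsum => i; apply: derivableM; first exact: derivable_cst.
  apply: derivableM; first exact: derivable_cst.
  have Dp a b c : derivable (partial a (fun w => G w b c)) u v.
    exact: (smooth_derivable Uo (smooth_partial a (smG b c)) Uu).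
  by apply: derivableB => //; exact: derivableD.
have Dinv : derivable (fun w => invmx (G w)) u v.
  apply: derivable_invmx; last exact: smooth_mx_derivable.
  by apply: filterS (near_open Uu) => w; exact: unitG.
by have [] := is_derive_mulmx (derivableP Dlow) (derivableP Dinv).
Qed.

Lemma connection_torsion_free u x y : U u ->
  y *m connection G x u = x *m connection G y u.
Proof.
move=> Uu; rewrite !mulmxA; congr (_ *m _); apply/rowP => l; rewrite !mxE.
under eq_bigr do rewrite mxE mulr_sumr.
under [RHS]eq_bigr do rewrite mxE mulr_sumr.
rewrite exchange_big; apply: eq_bigr => i _; apply: eq_bigr => j _ /=.
rewrite mulrCA; congr (_ * (_ * (_ * _))).
by rewrite (partial_metric_sym l i j)// [X in X - _]addrC.
Qed.

Definition dmetric x u : 'M[R]_n := \matrix_(i, j) 'D_x (fun v => G v i j) u.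

Lemma is_derive_metric u x : U u -> is_derive u x G (dmetric x u).
Proof.
move=> Uu; apply/is_derive_mxP => i j; rewrite mxE; apply: derivableP.
exact: (smooth_derivable Uo (smG i j) Uu).
Qed.

(** The Levi-Civita connection is metric: symmetrizing the Christoffel symbols of
the first kind in their last two indices leaves a single partial derivative. *)
Lemma connection_metric u x : U u ->
  dmetric x u = connection G x u *m G u + G u *m (connection G x u)^T.
Proof.
move=> Uu; rewrite /connection trmx_mul trmx_inv symG//.
rewrite mulmxKV ?unitG// mulKVmx ?unitG//.
apply/matrixP => j l; rewrite !mxE -big_split /=.
have [_ ->] := smooth_is_derive Uo x (smG j l) Uu.
apply: eq_bigr => i _; rewrite -mulrDr /lower_christoffel; congr (_ * _).
by rewrite (partial_metric_sym i l j)//; field.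
Qed.

(** The matrix of the curvature: [dOmega + Omega /\ Omega] evaluated at [(x, y)], with
the order of the products dictated by the action on row vectors. *)
Definition curvature_form x y u : 'M[R]_n :=
  'D_x (connection G y) u - 'D_y (connection G x) u
  + connection G y u *m connection G x u - connection G x u *m connection G y u.

Lemma is_derive_nabla_cst W u x y : smooth_mx U W -> U u ->
  is_derive u x (nabla G (fun=> y) W)
    (\row_k 'D_x ('D_y (fun v => W v 0 k)) u
     + ('D_x W u *m connection G y u + W u *m 'D_x (connection G y) u)).
Proof.
move=> sW Uu.
have D1 : is_derive u x (dirder (fun=> y) W)
    (\row_k 'D_x ('D_y (fun v => W v 0 k)) u).
  apply/is_derive_mxP => i k; rewrite mxE; under eq_fun do rewrite mxE.
  by apply: derivableP; have [] := is_derive2_smooth Uo y x (sW 0 k) Uu.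
have DW : is_derive u x W ('D_x W u).
  exact/derivableP/smooth_mx_derivable.
have Dc : is_derive u x (connection G y) ('D_x (connection G y) u).
  exact/derivableP/derivable_connection.
apply: near_eq_is_derive (is_deriveD D1 (is_derive_mulmx DW Dc)).
by apply: filterS (near_open Uu) => w Uw; exact/esym/nablaE.
Qed.

(** The derivatives of [W] cancel because its mixed second derivatives agree.  This
is the tensoriality of the curvature: the value at [u] depends on [W u] only, so
constant fields and the field [xi] may be exchanged. *)
Lemma curvatureE W u x y : smooth_mx U W -> U u ->
  curvature G (fun=> x) (fun=> y) W u = W u *m curvature_form x y u.
Proof.
move=> sW Uu; rewrite /curvature nabla_bracket_cst subr0.
have [hess hessC nabla2] : exists2 hess : 'rV[R]_n -> 'rV[R]_n -> 'rV[R]_n,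
    hess x y = hess y x &
    forall v w, nabla G (fun=> v) (nabla G (fun=> w) W) u = hess v w
     + ('D_v W u *m connection G w u + W u *m 'D_v (connection G w) u)
     + ('D_w W u + W u *m connection G w u) *m connection G v u.
  exists (fun v w => \row_k 'D_v ('D_w (fun z => W z 0 k)) u).
    have H k := smooth_schwarz Uo y x (sW 0 k) Uu.
    by apply/rowP => k; rewrite [LHS]mxE [RHS]mxE H.
  move=> v w; have DW : is_derive u w W ('D_w W u).
    exact/derivableP/smooth_mx_derivable.
  rewrite nablaE (dirderE (X := fun=> v) (is_derive_nabla_cst v w sW Uu)).
  by rewrite nablaE (dirderE (X := fun=> w) DW).
rewrite (nabla2 x y) (nabla2 y x) hessC.
exact: curvature_expansion.
Qed.

(** Differentiate the equation of a metric connection once more and antisymmetrize: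
the second derivatives of the metric cancel. *)
Lemma curvature_form_skew u x y : U u ->
  curvature_form x y u *m G u + G u *m (curvature_form x y u)^T = 0.
Proof.
move=> Uu.
pose hess v w : 'M[R]_n := \matrix_(i, j) 'D_v ('D_w (fun z => G z i j)) u.
have hessC : hess x y = hess y x.
  apply/matrixP => i j; rewrite [LHS]mxE [RHS]mxE.
  exact: (smooth_schwarz Uo y x (smG i j) Uu).
have dG v := is_derive_metric v Uu.
have hessE v w : hess v w =
    'D_v (connection G w) u *m G u + connection G w u *m dmetric v u
    + (dmetric v u *m (connection G w u)^T
       + G u *m ('D_v (connection G w) u)^T).
  have D1 : is_derive u v (dmetric w) (hess v w).
    apply/is_derive_mxP => i j; rewrite mxE; under eq_fun do rewrite mxE.
    by apply: derivableP; have [] := is_derive2_smooth Uo w v (smG i j) Uu.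
  have Dc : is_derive u v (connection G w) ('D_v (connection G w) u).
    exact/derivableP/derivable_connection.
  have D2 := is_deriveD (is_derive_mulmx Dc (dG v))
    (is_derive_mulmx (dG v) (is_derive_trmx Dc)).
  have [_ <-] := D1; have [_ <-] := D2; apply: near_eq_derive.
  by apply: filterS (near_open Uu) => z Uz; exact: connection_metric.
clearbody hess; move: hessC; rewrite (hessE x y) (hessE y x).
rewrite (connection_metric x Uu) (connection_metric y Uu).
exact: skew_expansion.
Qed.

End Curvature.

(** * Para-Sasakian structures in one chart *)

Section ParaSasakianChart.
Context (R : realType) (n : nat) (U : set 'rV[R]_n) (Uo : open U).
Context (G : 'rV[R]_n -> 'M[R]_n) (smG : smooth_mx U G).
Hypothesis symG : forall u, U u -> (G u)^T = G u.
Hypothesis unitG : forall u, U u -> G u \in unitmx.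
Context (eps : R) (phi : 'rV[R]_n -> 'M[R]_n) (xi : 'rV[R]_n -> 'rV[R]_n).
Context (eta : 'rV[R]_n -> 'cV[R]_n).
Hypotheses (smphi : smooth_mx U phi) (smxi : smooth_mx U xi).
Hypothesis eps_sign : eps = 1 \/ eps = -1.
Hypothesis paracontact : forall u, U u ->
  [/\ phi u *m phi u = 1%:M - eta u *m xi u, xi u *m eta u = 1%:M,
      xi u *m phi u = 0 & phi u *m eta u = 0].
Hypothesis compatible : forall u, U u -> forall x y,
  form_of (G u) (x *m phi u) (y *m phi u) =
  form_of (G u) x y - eps * (x *m eta u) 0 0 * (y *m eta u) 0 0.
Hypothesis sasakian : forall X Y, smooth_mx U X -> smooth_mx U Y ->
  forall u, U u -> nabla_endo G phi X Y u =
    - (form_of (G u) (X u *m phi u) (Y u *m phi u) *: xi u)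
    - (eps * (Y u *m eta u) 0 0) *: (X u *m phi u *m phi u).
Implicit Types (u x y w a b : 'rV[R]_n).

Let epsM : eps * eps = 1.
Proof. by case: eps_sign => ->; rewrite ?mulrNN mulr1. Qed.

(** [eta] is [eps] times the metric dual of [xi]: put [xi], which [phi] kills, in the
compatibility condition. *)
Lemma metric_xi u : U u -> G u *m (xi u)^T = eps *: eta u.
Proof.
move=> Uu; have [_ xieta xiphi _] := paracontact Uu.
apply/colP => k; have := compatible Uu (delta_mx 0 k) (xi u).
rewrite xiphi xieta /form_of trmx0 mulmx0 -mulmxA -!rowE !mxE mulr1.
by move/esym/eqP; rewrite subr_eq0 => /eqP.
Qed.

Lemma form_xi u a : U u -> form_of (G u) a (xi u) = eps * (a *m eta u) 0 0.
Proof. by move=> Uu; rewrite /form_of -mulmxA metric_xi// -scalemxAr mxE. Qed.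

Lemma form_sym u a b : U u -> form_of (G u) a b = form_of (G u) b a.
Proof.
move=> Uu; rewrite /form_of; transitivity ((a *m G u *m b^T)^T 0 0).
  by rewrite [RHS]mxE.
by rewrite !trmx_mul trmxK symG// mulmxA.
Qed.

Lemma xi_norm u : U u -> xi u *m G u *m (xi u)^T = eps%:M.
Proof.
move=> Uu; have [_ xieta _ _] := paracontact Uu.
by rewrite -mulmxA metric_xi// -scalemxAr xieta scale_scalar_mx mulr1.
Qed.

(** [xi] has constant length, so its covariant derivative is orthogonal to it. *)
Lemma eta_nabla_xi u x : U u -> nabla G (fun=> x) xi u *m eta u = 0.
Proof.
move=> Uu.
have Dxi : is_derive u x xi ('D_x xi u).
  exact/derivableP/(smooth_mx_derivable Uo).
have DG := is_derive_metric Uo smG x Uu.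
have [_ D] := is_derive_mulmx (is_derive_mulmx Dxi DG) (is_derive_trmx Dxi).
have D0 : 'D_x (fun w => xi w *m G w *m (xi w)^T) u = 0.
  rewrite -[RHS](derive_cst (eps%:M : 'M[R]_1) u x); apply: near_eq_derive.
  by apply: filterS (near_open Uo Uu) => w; exact: xi_norm.
rewrite nablaE (dirderE (X := fun=> x) Dxi).
move: D; rewrite D0 (connection_metric Uo smG symG unitG x Uu).
set W := connection G x u; set N := 'D_x xi u + _ => D.
have symD : N *m eta u + (N *m eta u)^T = 0.
  have -> : N *m eta u = eps *: (N *m G u *m (xi u)^T).
    by rewrite -mulmxA metric_xi// -scalemxAr scalerA epsM scale1r.
  rewrite [X in _ + X]linearZ /= -scalerDr norm_expansion; last exact: symG.
  by rewrite -D scaler0.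
apply/matrixP => i j; rewrite !ord1 [RHS]mxE.
have := congr1 (fun A : 'M[R]_1 => A 0 0) symD.
rewrite [LHS]mxE [X in _ + X]mxE [RHS]mxE.
by move: (_ 0 0) => r; lra.
Qed.

(** Since [phi] kills [xi], the Sasakian condition for [xi] determines the image under
[phi] of the covariant derivative of [xi]; applying [phi] again recovers the
derivative up to its component along [xi], which vanishes. *)
Lemma nabla_xi u x : U u -> nabla G (fun=> x) xi u = eps *: (x *m phi u).
Proof.
move=> Uu; have [phi2 xieta xiphi phieta] := paracontact Uu.
have := sasakian (smooth_mx_cst _ x) smxi Uu.
rewrite /nabla_endo (@nabla_near_eq _ _ _ _ _ (fun=> 0)); last first.
  by apply: filterS (near_open Uo Uu) => w Uw; have [] := paracontact Uw.
rewrite nablaE dirder_cst mul0mx addr0 sub0r xiphi xieta mxE mulr1.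
rewrite /form_of trmx0 mulmx0 mxE scale0r oppr0 sub0r => /oppr_inj nphi.
move: (congr1 (mulmx^~ (phi u)) nphi).
rewrite -mulmxA phi2 mulmxBr mulmx1 mulmxA eta_nabla_xi// mul0mx subr0 => ->.
rewrite -scalemxAl -!mulmxA; congr (_ *: _); congr (_ *m _).
by rewrite phi2 mulmxBr mulmx1 mulmxA phieta mul0mx subr0.
Qed.

(** Differentiating [nabla_y xi = eps y phi] leaves the covariant derivative of [phi],
which the Sasakian condition gives, plus a term symmetric in [x] and [y] because
the connection has no torsion. *)
Lemma xi_curvature_form u x y : U u ->
  xi u *m curvature_form G x y u =
  (x *m eta u) 0 0 *: y - (y *m eta u) 0 0 *: x.
Proof.
move=> Uu; have [phi2 xieta xiphi phieta] := paracontact Uu.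
rewrite -(curvatureE Uo smG unitG)// /curvature nabla_bracket_cst subr0.
have nabla2 v w : nabla G (fun=> v) (nabla G (fun=> w) xi) u =
    eps *: (nabla_endo G phi (fun=> v) (fun=> w) u
            + w *m connection G v u *m phi u).
  rewrite (@nabla_near_eq _ _ _ _ _ (fun z => eps *: (w *m phi z))); last first.
    by apply: filterS (near_open Uo Uu) => z Uz; exact: nabla_xi.
  have Dphi : is_derive u v phi ('D_v phi u).
    exact/derivableP/(smooth_mx_derivable Uo).
  have Dw := is_derive_mulmx (is_derive_cst w u v) Dphi.
  have De := is_deriveZ eps Dw.
  rewrite /nabla_endo !nablaE dirder_cst add0r.
  rewrite (dirderE (X := fun=> v) De) (dirderE (X := fun=> v) Dw).
  by rewrite subrK -scalemxAl -scalerDr.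
rewrite (nabla2 x y) (nabla2 y x).
rewrite (connection_torsion_free Uo symG x y Uu).
rewrite -scalerBr opprD addrACA subrr addr0.
have phi2E z : z *m phi u *m phi u = z - (z *m eta u) 0 0 *: xi u.
  rewrite -mulmxA phi2 mulmxBr mulmx1 mulmxA.
  by rewrite [in LHS](mx11_scalar (z *m eta u)) mul_scalar_mx.
have nabla_phi v w : nabla_endo G phi (fun=> v) (fun=> w) u =
    - (form_of (G u) (v *m phi u) (w *m phi u) *: xi u)
    - (eps * (w *m eta u) 0 0) *: (v - (v *m eta u) 0 0 *: xi u).
  by rewrite (sasakian (smooth_mx_cst _ v) (smooth_mx_cst _ w) Uu) phi2E.
rewrite (nabla_phi x y) (nabla_phi y x) (form_sym _ _ Uu).
move: (form_of _ _ _) ((x *m eta u) 0 0) ((y *m eta u) 0 0) => f c d.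
(* Every surviving term carries [eps ^+ 2 = 1]. *)
rewrite -[RHS]scale1r -epsM.
by apply/rowP => k; rewrite !mxE; ring.
Qed.

Lemma curv_atE u x y w : U u -> curv_at G u x y w = w *m curvature_form G x y u.
Proof.
move=> Uu; rewrite /curv_at (curvatureE Uo smG unitG)//.
exact: smooth_mx_cst.
Qed.

Lemma ricciE u y w : U u ->
  ricci G u y w = \sum_i (w *m curvature_form G (delta_mx 0 i) y u) 0 i.
Proof.
by move=> Uu; apply: eq_bigr => i _; rewrite mxE curv_atE.
Qed.

(** Trace of [xi_curvature_form]. *)
Lemma ricci_xi u y : U u ->
  ricci G u y (xi u) = (1 - n%:R) * (y *m eta u) 0 0.
Proof.
move=> Uu; rewrite ricciE//.
have entry (c d : R) i : (c *: y - d *: delta_mx 0 i) 0 i = c * y 0 i - d.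
  by rewrite !mxE !eqxx mulr1.
under eq_bigr => i _ do rewrite xi_curvature_form// entry -rowE [row _ _ _ _]mxE.
rewrite sumrB sumr_const card_ord mulrBl mul1r mulr_natl; congr (_ - _).
by rewrite [RHS]mxE; apply: eq_bigr => i _; rewrite mulrC.
Qed.

Lemma ricciB u y c d w w' : U u ->
  ricci G u y (c *: w - d *: w') = c * ricci G u y w - d * ricci G u y w'.
Proof.
move=> Uu; rewrite !ricciE// !mulr_sumr -sumrB; apply: eq_bigr => i _.
rewrite mulmxBl -!scalemxAl.
by move: (w *m _) (w' *m _) => s t; rewrite !mxE.
Qed.

(** Evaluate the pseudosymmetry equation at [y = b = xi].  As [Z] and the metric are
proportional against [xi], with factor [kap * eps], and the curvature is
skew-adjoint, only the terms where [R(x, xi) xi] and its counterpart for the wedge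
occur in the second slot of [Z - kap * eps * g] survive; these two vectors differ by
the factor [- eps]. *)
Lemma pseudosymmetric_chart (psi L : R) u
    (Z := fun x y => ricci G u x y + psi * form_of (G u) x y) :
  U u ->
  (forall x y a b, curv_dot G u Z x y a b
     = L * tachibana (form_of (G u)) Z a b x y) ->
  forall a x,
    (L + eps) * (ricci G u a x - (1 - n%:R) * eps * form_of (G u) a x) = 0.
Proof.
move=> Uu pseudo a x; have [_ xieta _ _] := paracontact Uu.
(* [Z(c, xi) = kap * eta(c)], by [ricci_xi] and [form_xi]. *)
pose kap := 1 - n%:R + psi * eps.
have Zxi c : Z c (xi u) = kap * (c *m eta u) 0 0.
  by rewrite /Z ricci_xi// form_xi// /kap; ring.
have xieta00 : (xi u *m eta u) 0 0 = 1 by rewrite xieta mxE.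
have ZB c d v w : Z a (c *: v - d *: w) = c * Z a v - d * Z a w.
  by rewrite /Z ricciB// form_ofB; ring.
have etaB c d v w : ((c *: v - d *: w) *m eta u) 0 0 =
    c * (v *m eta u) 0 0 - d * (w *m eta u) 0 0.
  by rewrite mulmxBl -!scalemxAl; move: (v *m _) (w *m _) => s t; rewrite !mxE.
(* [eta] is dual to [xi], so skew-adjointness moves the curvature onto [xi]. *)
have etaR : (a *m curvature_form G x (xi u) u *m eta u) 0 0
    = eps * form_of (G u) a x - (x *m eta u) 0 0 * (a *m eta u) 0 0.
  set K := curvature_form G x (xi u) u.
  have KG : K *m G u = - (G u *m K^T).
    apply/eqP; rewrite -addr_eq0.
    by rewrite (curvature_form_skew Uo smG symG unitG x (xi u) Uu).
  have -> : (a *m K *m eta u) 0 0 = - (eps * form_of (G u) a (xi u *m K)).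
    rewrite -[eta u]scale1r -epsM -scalerA -metric_xi// -scalemxAr [LHS]mxE -mulrN.
    congr (_ * _); rewrite /form_of trmx_mul.
    rewrite mulmxA -[a *m K *m _]mulmxA KG mulmxN mulNmx.
    by rewrite [LHS]mxE !mulmxA.
  rewrite /K xi_curvature_form// form_ofB form_xi// xieta00 mul1r.
  by rewrite -[in RHS](mul1r ((x *m eta u) 0 0)) -epsM; ring.
have := pseudo x (xi u) a (xi u).
rewrite /curv_dot /tachibana !curv_atE// !Zxi xi_curvature_form// /wedge.
rewrite !ZB etaR etaB (form_sym (xi u) a Uu) (form_sym x a Uu) !form_xi//.
rewrite !Zxi xieta00 /Z /kap.
move: (form_of _ _ _) (ricci _ _ _ _) (_ *m _) (_ *m _) => f s A X.
move: (A 0 0) (X 0 0) (n%:R) => p q m E.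
by case: eps_sign E => ->; lra.
Qed.

(** Where [Z] vanishes the Ricci tensor is a multiple of the metric, and its value at
[(xi, xi)] determines the factor. *)
Lemma vanishing_Z_ricci (psi : R) u : U u ->
  (forall a b, ricci G u a b + psi * form_of (G u) a b = 0) ->
  forall a b, ricci G u a b = (1 - n%:R) * eps * form_of (G u) a b.
Proof.
move=> Uu Z0 a b; have [_ xieta _ _] := paracontact Uu.
have := Z0 (xi u) (xi u).
rewrite ricci_xi// form_xi// xieta mxE !mulr1 => psiE.
have -> : (1 - n%:R) * eps = - psi.
  by move: psiE; case: eps_sign => ->; lra.
by apply/eqP; rewrite mulNr -addr_eq0 Z0.
Qed.

End ParaSasakianChart.

(** * From charts to the manifold *)

Lemma has_index_unitmx (R : realType) n (G : 'M[R]_n) nu :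
  has_index G nu -> G \in unitmx.
Proof.
case=> P unitP /(congr1 (fun A => A \in unitmx)).
rewrite !unitmx_mul unitmx_tr unitP andbT /= => ->.
rewrite unitmxE det_diag unitfE prodf_seq_neq0; apply/allP => k _ /=.
by rewrite mxE; case: ifP => _; rewrite ?oppr_eq0 oner_eq0.
Qed.

Theorem mainTheorem2 (R : realType) (M : manifold R 3) (eps : R)
    (phi : endoField M) (xi : vectorField M) (eta : oneForm M)
    (g : semiRiemannianMetric M)
    (psi L : M -> R)
    (hM : para_sasakian eps phi xi eta g)
    (hZ : Z_pseudosymmetric g psi L) :
  exists lam : R, forall p : M,
    einstein_at g lam p \/ (UZ g psi p /\ L p = - eps).
Proof.
case: hM => -[eps_sign paracontact compatible] sasakian.
exists ((1 - 3%:R) * eps) => p.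
have [|] := pselect (einstein_at g ((1 - 3%:R) * eps) p); first by left.
move=> /existsNP[i /not_implyP[dip /existsNP[x /existsNP[y /eqP Sxy]]]]; right.
have Uo : open (cimg i) by exact: img_open.
have Uu : cimg i (Defs.coord i p) by exists p.
have unitG u : cimg i u -> g i u \in unitmx.
  by have [nu _ /(_ i u)] := met_index g => /[apply]; exact: has_index_unitmx.
have symG u : cimg i u -> (g i u)^T = g i u by exact: met_sym.
have smG : smooth_mx (cimg i) (g i) by exact: met_smooth.
have smphi : smooth_mx (cimg i) (phi i) by exact: ef_smooth.
have smxi : smooth_mx (cimg i) (xi i) by exact: vf_smooth.
(* If [Z] vanished at [p] in this chart, then [S = lam g] would hold there. *)
have UZp : UZ g psi p.
  apply: contrapT => nUZ; move/eqP: Sxy; apply.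
  apply: (vanishing_Z_ricci Uo smG symG unitG smphi smxi eps_sign
    (paracontact i) (compatible i) (sasakian i) (psi := psi p) Uu) => a b.
  apply: contrapT => /eqP Zab; apply: nUZ; exists i => //.
  by exists a, b.
split=> //.
have := pseudosymmetric_chart Uo smG symG unitG smphi smxi eps_sign
  (paracontact i) (compatible i) (sasakian i) Uu (hZ p UZp i dip) x y.
move=> /eqP; rewrite mulf_eq0 subr_eq0 addr_eq0 => /orP[/eqP //|].
by move=> /eqP S0; move/eqP: Sxy; case.
Qed.
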